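(* For $n\ge 1$ let $P_n$ be the Legendre polynomial of degree $n$ and let $\theta_1<\theta_2<\cdots<\theta_n$ (depending on $n$) be the increasing sequence of zeros of $\theta\mapsto P_n(\cos\theta)$ in $(0,\pi)$. Let $I\subseteq(0,\pi)$ be a closed (compact) interval. Then there is a constant $C$, which may depend on $I$ but not on $n$, such that for every $n\ge 1$ for which $I$ contains an even number of the zeros $\theta_1,\dots,\theta_n$, $$\left|\;\bigg|\sum_{j:\,\theta_j\in I}(-1)^j\theta_j\bigg|-\frac{\operatorname{length}(I)}{2}\;\right|\le \frac{C}{n}.$$
   Context: The Legendre polynomial $P_n$ is the standard one, normalized by $P_n(1)=1$, orthogonal on $[-1,1]$ with respect to Lebesgue measure. Its $n$ zeros are simple and lie in $(-1,1)$, so $P_n(\cos\theta)$ has exactly $n$ zeros in $(0,\pi)$. The index $j$ in the sum is the index of $\theta_j$ in the full increasing list of the $n$ zeros in $(0,\pi)$. *)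

(* Defs.v *)
From HB Require Import structures.
From mathcomp Require Import all_boot all_order all_algebra.
From mathcomp Require Import all_classical all_reals all_analysis.

Set Implicit Arguments.
Unset Strict Implicit.
Unset Printing Implicit Defensive.

Import Order.TTheory GRing.Theory Num.Theory.
Import numFieldNormedType.Exports.

Local Open Scope classical_set_scope.
Local Open Scope ring_scope.

(* [size p = n.+1] says that p has degree exactly n. *)
Definition legendre_polynomials (R : realType) (P : nat -> {poly R}) : Prop :=
  [/\ forall n, size (P n) = n.+1,
      forall n, (P n).[1] = 1 &
      forall m n, m <> n ->
        \int[lebesgue_measure]_(x in `[(-1 : R), 1]) ((P m).[x] * (P n).[x])
          = 0].

(* No length is imposed on the list: having exactly n entries when
   p = P_n is a consequence, not an assumption. *)
Definition increasing_cos_zeros (R : realType) (p : {poly R}) (theta : seq R)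
    : Prop :=
  sorted <%R theta /\
  forall t, t \in theta <-> [/\ 0 < t, t < pi & p.[cos t] = 0].

(* theta is indexed from 0, so that theta_j in the usual 1-based numbering is
   [theta`_(j.-1)]; hence the exponent j.+1. *)
Definition alternating_sum (R : realType) (a b : R) (theta : seq R) : R :=
  \sum_(j < size theta | a <= theta`_j <= b) (-1) ^+ j.+1 * theta`_j.

(* Main.v *)
Require Import Defs.
From HB Require Import structures.
From mathcomp Require Import all_boot all_order all_algebra.
From mathcomp Require Import all_classical all_reals all_analysis.
From mathcomp Require Import ring lra.

Set Implicit Arguments.
Unset Strict Implicit.
Unset Printing Implicit Defensive.

Import Order.TTheory GRing.Theory Num.Theory.
Import numFieldNormedType.Exports.

Local Open Scope ring_scope.

(** Put N = n + 1/2.  The function u(t) = sqrt(sin t) P_n(cos t) satisfies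
    u'' + Q u = 0 with Q(t) = N^2 + 1/(4 sin^2 t), and has the same zeros as
    P_n(cos t) in (0, pi).  On the compact interval I = [a, b] the second term
    of Q stays below a constant K, so that N^2 <= Q <= M^2 with M = N + K/N.
    Sturm comparison with the equations of constant coefficients N^2 and M^2
    then says that every interval of length pi/N inside I contains a zero
    ([sturm_zero]) and that consecutive zeros in I are at least pi/M apart
    ([sturm_gap]).  All gaps between consecutive zeros thus lie in
    [pi/M, pi/N], a window of width O(n^-3): the zeros are almost equally
    spaced.

    If I contains 2m zeros, the alternating sum is up to sign the sum of m
    gaps, one out of two, while the length of I is the sum of all 2m - 1 gaps
    plus two end pieces of length at most pi/N.  Hence the alternating sum
    differs from half the length by at most m (pi/N - pi/M) + pi/(2N)
    ([alternating_sum_gaps]), which is O(1/n) because m = O(n).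

    The equation for u comes from the Legendre equation, which has to be
    derived from orthogonality ([legendre_equation]).  The Legendre operator
    L p = ((1 - x^2) p')' is symmetric for the integral over [-1, 1] and does
    not raise degrees, so r = L P_n + n (n + 1) P_n, whose coefficient of
    degree n cancels, is a polynomial of degree less than n orthogonal to all
    polynomials of degree less than n, in particular to itself; so r = 0. *)

(** * Integrals of polynomials over [-1, 1] *)

Lemma poly_primitive (R : numFieldType) (p : {poly R}) :
  exists F : {poly R}, F^`() = p.
Proof.
exists (\poly_(i < (size p).+1) (p`_i.-1 / i%:R)).
apply/polyP => i; rewrite coef_deriv coef_poly ltnS.
case: ltnP => [ip|pi]; last by rewrite mul0rn nth_default.
by rewrite /= -[LHS]mulr_natr divfK // pnatr_eq0.
Qed.

Section IntegralOfPolynomials.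
Variable R : realType.
Implicit Types p q F : {poly R}.

Definition intp p : R := \int[lebesgue_measure]_(x in `[(-1 : R), 1]) p.[x].

Lemma intp_deriv F : intp F^`() = F.[1] - F.[-1].
Proof.
rewrite /intp /Rintegral.
rewrite (@continuous_FTC2 _ (horner F^`()) (horner F) (-1) 1) //.
- by apply: continuous_subspaceT => x; exact: continuous_horner.
- split.
  + by move=> x _; exact: derivable_horner.
  + by apply: cvg_at_right_filter; exact: continuous_horner.
  + by apply: cvg_at_left_filter; exact: continuous_horner.
- by move=> x _; rewrite derivE.
Qed.

Lemma intpD p q : intp (p + q) = intp p + intp q.
Proof.
have [[F <-] [G <-]] := (poly_primitive p, poly_primitive q).
by rewrite -derivD !intp_deriv !hornerD; ring.
Qed.

Lemma intpZ c p : intp (c *: p) = c * intp p.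
Proof.
have [F <-] := poly_primitive p.
by rewrite -derivZ !intp_deriv !hornerZ; ring.
Qed.

(** A primitive F of p^2 is nondecreasing on [-1, 1]; if its increment vanishes
    it is constant there, and a polynomial with infinitely many equal values
    is constant. *)
Lemma intp_sqr_eq0 p : intp (p * p) = 0 -> p = 0.
Proof.
have [F dF] := poly_primitive (p * p).
rewrite -dF intp_deriv => /eqP; rewrite subr_eq0 => /eqP F1.
have F_mono x y : -1 <= x -> x <= y -> y <= 1 -> F.[x] <= F.[y].
  move=> x1 xy y1.
  have [//| c _ /eqP] := @MVT_segment R (horner F) (horner F^`()) x y xy.
  - exact: continuous_subspaceT (@continuous_horner _ _).
  - rewrite subr_eq => /eqP ->.
    by rewrite lerDr mulr_ge0 ?subr_ge0 // dF hornerM sqr_ge0.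
have F_cst x : -1 <= x <= 1 -> root (F - (F.[1])%:P) x.
  move=> /andP[x1 x2]; rewrite rootE !hornerE subr_eq0 eq_le F_mono //=.
  by rewrite F1 F_mono.
have /eqP : F - (F.[1])%:P = 0.
  apply/eqP; case: eqVneq => // F_neq0.
  (* The points 1/(i+1) are more distinct roots in [-1, 1] than the size of
     the polynomial allows. *)
  pose s : seq R := [seq i.+1%:R^-1 | i <- iota 0 (size (F - (F.[1])%:P))].
  have := max_poly_roots F_neq0 (_ : all _ s) (_ : uniq s).
  rewrite size_map size_iota ltnn => -> //.
  - apply/allP => _ /mapP[i _ ->]; apply: F_cst.
    have i0 : 0 <= i.+1%:R^-1 :> R by rewrite invr_ge0.
    have i1 : i.+1%:R^-1 <= 1 :> R by rewrite invf_le1 ?ler1n ?ltr0n.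
    by rewrite i1 andbT (le_trans _ i0) // lerN10.
  - rewrite map_inj_uniq ?iota_uniq // => i j /invr_inj /eqP.
    by rewrite eqr_nat => /eqP[].
rewrite subr_eq0 => /eqP FC; apply/eqP; rewrite -sqrf_eq0 expr2 -dF FC.
by rewrite derivC.
Qed.

End IntegralOfPolynomials.

(** * The Legendre differential equation *)

Section LegendreEquation.
Variable R : realType.
Implicit Types p q : {poly R}.

Definition legendre_op p : {poly R} := ((1 - 'X^2) * p^`())^`().

Lemma coef_legendre_op p i :
  (legendre_op p)`_i = (i.+1 * i.+2)%:R * p`_i.+2 - (i * i.+1)%:R * p`_i.
Proof.
rewrite coef_deriv mulrBl mul1r coefB mulrC coefMXn !coef_deriv.
case: i => [|[|i]] /=; rewrite ?subn2 /= ?coef_deriv.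
- by rewrite subr0 mul0n mul0r subr0 mulr1n mulr_natl.
- by rewrite mulrnBl -!mulrnA !mulr_natl.
- by rewrite mulrnBl -!mulrnA !mulr_natl mulnC.
Qed.

Lemma size_legendre_op p : (size (legendre_op p) <= size p)%N.
Proof.
apply/leq_sizeP => i pi; rewrite coef_legendre_op !nth_default ?mulr0 ?subrr //.
by apply: leq_trans pi _; rewrite -addn2 leq_addr.
Qed.

(** Green's identity: L p * q - p * L q is the derivative of
    (1 - x^2) (p' q - p q'), which vanishes at both end points. *)
Lemma legendre_op_sym p q : intp (legendre_op p * q) = intp (p * legendre_op q).
Proof.
have -> : legendre_op p * q =
    p * legendre_op q + ((1 - 'X^2) * (p^`() * q - p * q^`()))^`().
  by rewrite /legendre_op !(derivM, derivB); ring.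
rewrite intpD intp_deriv !hornerE /=; ring.
Qed.

Variable P : nat -> {poly R}.
Hypothesis hP : legendre_polynomials P.

(** As P_k has exact degree k, the polynomials P_0, ..., P_(n-1) span all
    polynomials of degree less than n; the induction removes one leading
    coefficient at a time. *)
Lemma legendre_orthogonal n q : (size q <= n)%N -> intp (P n * q) = 0.
Proof.
have [sP _ oP] := hP.
suff H k (r : {poly R}) :
  (k <= n)%N -> (size r <= k)%N -> intp (P n * r) = 0 by apply: H.
elim: k r => [|k IHk] r kn.
  rewrite leqn0 size_poly_eq0 => /eqP ->.
  by rewrite mulr0 -[0](scale0r 0) intpZ mul0r.
move=> rk; pose c := r`_k / (P k)`_k.
have Pk0 : (P k)`_k != 0.
  have := lead_coef_eq0 (P k); rewrite lead_coefE sP /= => ->.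
  by rewrite -size_poly_eq0 sP.
have -> : P n * r = P n * (r - c *: P k) + c *: (P n * P k).
  by rewrite mulrBr scalerAr subrK.
rewrite intpD intpZ [X in c * X](_ : _ = 0); last first.
  rewrite /intp -[RHS](oP n k); last by move=> nk; rewrite nk ltnn in kn.
  by apply: eq_Rintegral => x _; rewrite hornerM.
rewrite mulr0 addr0 IHk ?(ltnW kn) //; apply/leq_sizeP => i; rewrite leq_eqVlt.
case/predU1P => [<-|ki]; first by rewrite coefB coefZ /c divfK ?subrr.
rewrite coefB coefZ !nth_default ?mulr0 ?subrr ?sP //.
exact: leq_trans rk ki.
Qed.

(** The defect r has degree less than n and is orthogonal to itself: its
    pairing with L P_n moves to P_n against L r by symmetry. *)
Lemma legendre_equation n : legendre_op (P n) = - (n * n.+1)%:R *: P n.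
Proof.
have [sP _ _] := hP.
pose r := legendre_op (P n) + (n * n.+1)%:R *: P n.
suff /eqP : r = 0 by rewrite addr_eq0 scaleNr => /eqP.
have sr : (size r <= n)%N.
  apply/leq_sizeP => i; rewrite coefD coefZ coef_legendre_op leq_eqVlt.
  case/predU1P => [<-|ni]; last first.
    by rewrite !nth_default ?mulr0 ?subrr ?addr0 // sP // ltnW // ltnW.
  by rewrite (@nth_default _ _ _ n.+2) ?sP //; ring.
apply: intp_sqr_eq0.
rewrite {1}/r mulrDl intpD legendre_op_sym -scalerAl intpZ.
by rewrite !legendre_orthogonal ?mulr0 ?addr0 // (leq_trans (size_legendre_op _)).
Qed.

Lemma legendre_equation_horner n x :
  (1 - x ^+ 2) * (P n)^`()^`().[x] - 2 * x * (P n)^`().[x]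
    = - (n * n.+1)%:R * (P n).[x].
Proof.
have := congr1 (horner^~ x) (legendre_equation n).
rewrite /legendre_op derivM derivB derivXn -polyC1 derivC !hornerE /= => <-.
by ring.
Qed.

End LegendreEquation.

(** * Sturm comparison *)

Section SturmComparison.
Variable R : realType.
Implicit Types (f u v : R -> R) (x y : R).

Lemma MVT_is_derive f df a b : a < b ->
  (forall x, a <= x <= b -> is_derive x 1 f (df x)) ->
  exists2 c, a < c < b & f b - f a = df c * (b - a).
Proof.
move=> ab hf; have [||c cab E] := @MVT R f df a b ab.
- by move=> x; rewrite in_itv /= => /andP[ax xb]; apply: hf; rewrite !ltW.
- apply: derivable_within_continuous => x; rewrite in_itv /= => xab.
  by have [] := hf x xab.
- by exists c => //; move: cab; rewrite in_itv.
Qed.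

Lemma nonvanishing_same_sign f (i : interval R) :
  (forall x, x \in i -> derivable f x 1) -> (forall x, x \in i -> f x != 0) ->
  forall x y, x \in i -> y \in i -> 0 < f x * f y.
Proof.
move=> df f0 x y; wlog xy : x y / x <= y => [H xi yi|xi yi].
  by have [/H|/ltW /H] := leP x y; [apply|rewrite mulrC; apply].
have sub z : z \in `[x, y] -> z \in i.
  rewrite in_itv /= => /andP[xz zy].
    by apply: (interval_is_interval xi yi); rewrite xz zy.
rewrite lt_neqAle eq_sym mulf_neq0 ?f0 //= leNgt; apply/negP => fxy.
have [||c /sub /f0 /eqP //] := @IVT R f x y 0 xy.
- by apply: derivable_within_continuous => z /sub /df.
- rewrite ge_min le_max; move: fxy; case: (ltgtP (f x) 0) => [fx|fx|->].
  + by rewrite nmulr_rlt0 // => /ltW ->; rewrite orbT.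
  + by rewrite pmulr_rlt0 // => /ltW ->.
  + by rewrite mul0r ltxx.
Qed.

Lemma is_derive_sin_affine M al x :
  is_derive x 1 (fun x => sin (M * (x - al))) (M * cos (M * (x - al))).
Proof.
have -> : (fun x => sin (M * (x - al))) = sin \o (M \*: (id - cst al)) by [].
apply: is_derive_eq; rewrite /= subr0; rewrite /GRing.scale /=. ring.
Qed.

Lemma is_derive_cos_affine M al x :
  is_derive x 1 (fun x => M * cos (M * (x - al))) (- M ^+ 2 * sin (M * (x - al))).
Proof.
have -> : (fun x => M * cos (M * (x - al))) =
  M \*: (cos \o (M \*: (id - cst al))) by [].
apply: is_derive_eq; rewrite /= subr0 /GRing.scale /=. ring.
Qed.

(** The key identity of Sturm theory: the Wronskian of solutions of u'' = p u
    and v'' = q v has derivative (p - q) u v, so its monotonicity is decided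
    by comparing the two coefficients. *)
Lemma is_derive_wronskian u u1 v v1 (p q : R) x :
  is_derive x 1 u (u1 x) -> is_derive x 1 u1 (p * u x) ->
  is_derive x 1 v (v1 x) -> is_derive x 1 v1 (q * v x) ->
  is_derive x 1 (fun x => u1 x * v x - u x * v1 x) ((p - q) * (u x * v x)).
Proof.
move=> *.
have -> : (fun x => u1 x * v x - u x * v1 x) = u1 * v - u * v1 by [].
apply: is_derive_eq; rewrite /GRing.scale /=; ring.
Qed.

Lemma is_derive_ratio u u1 v v1 x : v x != 0 ->
  is_derive x 1 u (u1 x) -> is_derive x 1 v (v1 x) ->
  is_derive x 1 (fun x => u x / v x) ((u1 x * v x - u x * v1 x) / v x ^+ 2).
Proof.
move=> v0 du dv.
have -> : (fun x => u x / v x) = u * (fun x => (v x)^-1) by [].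
apply: is_derive_eq; rewrite /GRing.scale /=; field => //.
Qed.

Lemma sin_affine_gt0 M al x : 0 < M -> al < x < al + pi / M ->
  0 < sin (M * (x - al)).
Proof.
move=> M0 /andP[alx xal]; apply: sin_gt0_pi.
by rewrite mulr_gt0 ?subr_gt0 //= mulrC -ltr_pdivlMr // ltrBlDl.
Qed.

(** Compare with v(x) = sin (N (x - al)), positive inside the interval and zero
    at both ends.  If u kept a constant sign, say positive, then the Wronskian
    u' v - u v' would be negative at the left end and positive at the right
    end, although its derivative (N^2 - Q) u v is nonpositive. *)
Lemma sturm_zero u u1 Q N al : 0 < N ->
  (forall x, al <= x <= al + pi / N -> is_derive x 1 u (u1 x)) ->
  (forall x, al <= x <= al + pi / N -> is_derive x 1 u1 (- Q x * u x)) ->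
  (forall x, al <= x <= al + pi / N -> N ^+ 2 <= Q x) ->
  exists2 z, al <= z <= al + pi / N & u z = 0.
Proof.
move=> N0 du du1 NQ; apply: contrapT => nz.
set e := al + pi / N in du du1 NQ nz *.
have ale : al < e by rewrite ltrDl divr_gt0 // pi_gt0.
have u_sign x y : al <= x <= e -> al <= y <= e -> 0 < u x * u y.
  move=> xe ye; apply: (@nonvanishing_same_sign u `[al, e]); rewrite ?in_itv //.
  - by move=> z; rewrite in_itv => /du [].
  - by move=> z; rewrite in_itv => ze; apply/eqP => uz; apply: nz; exists z.
have ali : al <= al <= e by rewrite lexx ltW.
have ei : al <= e <= e by rewrite lexx ltW.
have [c ce E] := MVT_is_derive ale (fun x xe =>
  is_derive_wronskian (du x xe) (du1 x xe)
  (is_derive_sin_affine N al x) (is_derive_cos_affine N al x)).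
have ci : al <= c <= e by case/andP: ce => *; rewrite !ltW.
have sc : 0 < sin (N * (c - al)) by exact: sin_affine_gt0.
move: E; have -> : N * (e - al) = pi.
  by rewrite /e addrC addKr mulrC divfK ?gt_eqF.
rewrite subrr mulr0 sin0 cos0 sinpi cospi => E.
have := NQ c ci; have := u_sign _ _ ali ali; have := u_sign _ _ ali ei.
have := u_sign _ _ ali ci => uc ue ua Qc.
(* The factor u al stands for the sign of u and spares a case split. *)
have : u al * (N * (u e + u al)) <= 0.
  have -> : N * (u e + u al) =
      (- Q c + N ^+ 2) * (u c * sin (N * (c - al))) * (e - al).
    by rewrite -[N ^+ 2]opprK -E; ring.
  rewrite [leLHS](_ : _ = - ((Q c - N ^+ 2) *
    ((u al * u c) * sin (N * (c - al)) * (e - al)))); last by ring.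
  rewrite oppr_le0 mulr_ge0 ?subr_ge0 // ltW // mulr_gt0 ?subr_gt0 //.
  exact: mulr_gt0.
apply/negP; rewrite leNgt negbK mulrCA mulrDr.
by apply: mulr_gt0; rewrite ?addr_gt0.
Qed.

(** If the gap were shorter than pi/M, a sine wave v of frequency M would be
    positive on the whole closed interval [be, ga].  With u positive inside,
    the ratio u/v rises from 0 and falls back to 0, so the Wronskian, which
    has the sign of (u/v)', is positive at some point and negative at a later
    one; but its derivative (M^2 - Q) u v is nonnegative. *)
Lemma sturm_gap u u1 Q M be ga : 0 < M -> be < ga ->
  (forall x, be <= x <= ga -> is_derive x 1 u (u1 x)) ->
  (forall x, be <= x <= ga -> is_derive x 1 u1 (- Q x * u x)) ->
  (forall x, be <= x <= ga -> Q x <= M ^+ 2) ->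
  u be = 0 -> u ga = 0 -> (forall x, be < x < ga -> u x != 0) ->
  pi / M <= ga - be.
Proof.
move=> M0 bg du du1 QM ube uga un0; rewrite leNgt; apply/negP => gap.
have u_sign x y : be < x < ga -> be < y < ga -> 0 < u x * u y.
  move=> xe ye; apply: (@nonvanishing_same_sign u `]be, ga[); rewrite ?in_itv //.
  - by move=> z; rewrite in_itv => /andP[? ?]; have [] // := du z _; rewrite !ltW.
(* A half-wave of length pi/M centred on [be, ga] sticks out on both sides. *)
pose al := be - (pi / M - (ga - be)) / 2.
pose v x := sin (M * (x - al)); pose v1 x := M * cos (M * (x - al)).
have v_gt0 x : be <= x <= ga -> 0 < v x.
  by move=> /andP[bx xg]; apply: sin_affine_gt0 => //; rewrite /al; lra.
have dv x : is_derive x 1 v (v1 x) by exact: is_derive_sin_affine.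
pose w x := u1 x * v x - u x * v1 x.
have dh x : be <= x <= ga -> is_derive x 1 (fun x => u x / v x) (w x / v x ^+ 2).
  by move=> xi; apply: is_derive_ratio => //; [rewrite gt_eqF // v_gt0|exact: du].
pose m := (be + ga) / 2.
have bm : be < m by rewrite /m; lra.
have mg : m < ga by rewrite /m; lra.
have mi : be < m < ga by rewrite bm.
have um := u_sign m m mi mi.
have [|x1 /andP[bx1 x1m] E1] := MVT_is_derive bm
    (f := fun x => u x / v x) (df := fun x => w x / v x ^+ 2).
  by move=> x /andP[? ?]; apply: dh; lra.
have [|x2 /andP[mx2 x2g] E2] := MVT_is_derive mg
    (f := fun x => u x / v x) (df := fun x => w x / v x ^+ 2).
  by move=> x /andP[? ?]; apply: dh; lra.
have x12 : x1 < x2 by exact: lt_trans x1m mx2.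
have [|c /andP[x1c cx2] E] := MVT_is_derive x12 (f := w)
    (df := fun x => (- Q x - - M ^+ 2) * (u x * v x)).
  move=> x /andP[? ?]; have xi : be <= x <= ga by lra.
  exact: is_derive_wronskian (du x xi) (du1 x xi) (dv x)
    (is_derive_cos_affine _ _ _).
have vm : 0 < v m by rewrite v_gt0 // !ltW.
have vx1 : 0 < v x1 by rewrite v_gt0 //; lra.
have vx2 : 0 < v x2 by rewrite v_gt0 //; lra.
have vc : 0 < v c by rewrite v_gt0 //; lra.
have W1 : 0 < u m * w x1.
  have -> : w x1 = (u m / v m) / (m - be) * v x1 ^+ 2.
    move: E1; rewrite ube mul0r subr0 => ->.
    by field; rewrite ?gt_eqF ?subr_gt0.
  rewrite [ltRHS](_ : _ = (u m * u m) * (v x1 ^+ 2 / (v m * (m - be)))); last first.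
    by field; rewrite ?gt_eqF ?subr_gt0.
  by rewrite mulr_gt0 ?divr_gt0 ?exprn_gt0 // mulr_gt0 ?subr_gt0.
have W2 : 0 < u m * - w x2.
  have -> : w x2 = - (u m / v m) / (ga - m) * v x2 ^+ 2.
    move: E2; rewrite uga mul0r sub0r => ->.
    by field; rewrite ?gt_eqF ?subr_gt0.
  rewrite [ltRHS](_ : _ = (u m * u m) * (v x2 ^+ 2 / (v m * (ga - m)))); last first.
    by field; rewrite ?gt_eqF ?subr_gt0.
  by rewrite mulr_gt0 ?divr_gt0 ?exprn_gt0 // mulr_gt0 ?subr_gt0.
have : 0 <= u m * (w x2 - w x1).
  rewrite E [leRHS](_ : _ =
    (M ^+ 2 - Q c) * ((u m * u c) * (v c * (x2 - x1)))); last by ring.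
  have umc : 0 < u m * u c by apply: u_sign => //; lra.
  rewrite mulr_ge0 ?subr_ge0 ?QM //; first lra.
  by rewrite ltW // mulr_gt0 // mulr_gt0 // subr_gt0.
by rewrite mulrBr; move: W1 W2; rewrite mulrN; lra.
Qed.

End SturmComparison.

(** * The Liouville normal form of the Legendre equation *)

Section LegendreSturmLiouville.
Variable R : realType.
Variable P : nat -> {poly R}.
Hypothesis hP : legendre_polynomials P.
Implicit Types (x t : R) (n : nat).

(** The factor sqrt (sin t) is what removes the first-order term cot t * y' of
    the equation satisfied by y(t) = P_n(cos t). *)
Definition legendre_u n t : R := Num.sqrt (sin t) * (P n).[cos t].

Definition legendre_u1 n t : R :=
  - Num.sqrt (sin t) ^+ 3 * (P n)^`().[cos t]
  + cos t / (2 * Num.sqrt (sin t)) * (P n).[cos t].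

Definition legendre_potential n t : R :=
  (n%:R + 2^-1) ^+ 2 + (4 * sin t ^+ 2)^-1.

Lemma legendre_u_eq0 n t : 0 < t < pi ->
  (legendre_u n t == 0) = ((P n).[cos t] == 0).
Proof.
by move=> /sin_gt0_pi st; rewrite mulf_eq0 sqrtr_eq0 leNgt st.
Qed.

Lemma is_derive_sqrt_sin t : 0 < sin t ->
  is_derive t 1 (fun t => Num.sqrt (sin t)) (cos t / (2 * Num.sqrt (sin t))).
Proof.
move=> st; have := is_derive1_sqrt st => ds.
have -> : (fun t => Num.sqrt (sin t)) = Num.sqrt \o (@sin R) by [].
by apply: is_derive_eq; rewrite mulrC.
Qed.

Lemma is_derive_horner_cos (p : {poly R}) t :
  is_derive t 1 (fun t => p.[cos t]) (- sin t * p^`().[cos t]).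
Proof.
have -> : (fun t => p.[cos t]) = horner p \o (@cos R) by [].
by apply: is_derive_eq; rewrite mulrC.
Qed.

Lemma is_derive_legendre_u n t : 0 < t < pi ->
  is_derive t 1 (legendre_u n) (legendre_u1 n t).
Proof.
move=> /sin_gt0_pi st; have := is_derive_sqrt_sin st => ds.
have dp := is_derive_horner_cos (P n) t.
have -> : legendre_u n =
  (fun t => Num.sqrt (sin t)) * (fun t => (P n).[cos t]) by [].
apply: is_derive_eq; rewrite /legendre_u1 /GRing.scale /=.
have := sqr_sqrtr (ltW st); move: (Num.sqrt (sin t)) => s <-; ring.
Qed.

(** With s = sqrt (sin t) and c = cos t, the claim is a combination of the
    Legendre equation at c and of c^2 + s^4 = 1. *)
Lemma is_derive_legendre_u1 n t : 0 < t < pi ->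
  is_derive t 1 (legendre_u1 n) (- legendre_potential n t * legendre_u n t).
Proof.
move=> /sin_gt0_pi st; have ds := is_derive_sqrt_sin st.
have dp := is_derive_horner_cos (P n) t.
have dp1 := is_derive_horner_cos (P n)^`() t.
have s0 : Num.sqrt (sin t) != 0 by rewrite gt_eqF ?sqrtr_gt0.
have dV := @is_deriveV _ (fun t => Num.sqrt (sin t)) t _ _ s0 ds.
have -> : legendre_u1 n =
  - (fun t => Num.sqrt (sin t)) ^+ 3 * (fun t => (P n)^`().[cos t]) +
    2^-1 \*: ((@cos R) * (fun t => (Num.sqrt (sin t))^-1) *
      (fun t => (P n).[cos t])).
  apply/funext => x; rewrite /legendre_u1 /=.
  rewrite !fctE /= invfM [_ *: _]mulrC; ring.
apply: is_derive_eq; rewrite !fctE.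
have := legendre_equation_horner hP n (cos t).
have := cos2Dsin2 t.
rewrite /legendre_potential /legendre_u /GRing.scale /=.
have := sqr_sqrtr (ltW st); move: (Num.sqrt (sin t)) s0 => s s0 <-.
move: (cos t) => c.
move: (P n).[c] (P n)^`().[c] (P n)^`()^`().[c] => p p1 p2.
move=> /eqP; rewrite -subr_eq0 => /eqP E1 /eqP; rewrite -subr_eq0 => /eqP E2.
apply/eqP; rewrite -subr_eq0; apply/eqP.
transitivity (s * ((1 - c ^+ 2) * p2 - 2 * c * p1 - - (n * n.+1)%:R * p)
  + (s * p2 - p / (4 * s ^+ 3)) * (c ^+ 2 + s ^+ 2 ^+ 2 - 1)).
  by rewrite natrM -natr1; field.
by rewrite E1 E2 !mulr0 addr0.
Qed.

Lemma legendre_potential_ge n t : (n%:R + 2^-1) ^+ 2 <= legendre_potential n t.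
Proof. by rewrite lerDl invr_ge0 mulr_ge0 // sqr_ge0. Qed.
End LegendreSturmLiouville.

(** * Alternating sums of almost equally spaced points *)

Section AlternatingSums.
Variable R : realType.
Implicit Types (a b x y g G : R) (s theta : seq R).

Fixpoint altsum s : R := if s is x :: s' then x - altsum s' else 0.

Lemma sum_filter_cons a b x s k :
  \sum_(j < size (x :: s) | a <= (x :: s)`_j <= b) (-1) ^+ (k + j) * (x :: s)`_j
  = (if a <= x <= b then (-1) ^+ k * x else 0)
    + \sum_(j < size s | a <= s`_j <= b) (-1) ^+ (k.+1 + j) * s`_j.
Proof.
rewrite big_mkcond big_ord_recl -big_mkcond /= addn0; congr (_ + _).
by apply: eq_bigr => i _; rewrite addSnnS.
Qed.

(** Once the entries are at least a, those that are at most b form a prefix,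
    so that the exponents of the selected entries are consecutive. *)
Lemma altsum_filter_ge a b s k : sorted <%R s -> all (>= a) s ->
  \sum_(j < size s | a <= s`_j <= b) (-1) ^+ (k + j) * s`_j
    = (-1) ^+ k * altsum [seq t <- s | a <= t <= b].
Proof.
elim: s k => [|x s IHs] k; first by rewrite big_ord0 mulr0.
move=> xs /= /andP[ax sa]; rewrite sum_filter_cons IHs ?(path_sorted xs) // ax /=.
case: leP => xb /=; first by rewrite exprS; ring.
rewrite (_ : [seq t <- s | a <= t <= b] = [::]) /= ?mulr0 ?addr0 //.
apply/eqP; rewrite -[_ == _]negbK -has_filter; apply/hasPn => y ys.
have /allP /(_ _ ys) /= xy := order_path_min lt_trans xs.
by rewrite [y <= b]leNgt (lt_trans xb xy) andbF.
Qed.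

(** The entries below a only shift the exponents.  The resulting sign is left
    unspecified, because the alternating sum is used through its absolute
    value. *)
Lemma altsum_filter a b s k : sorted <%R s ->
  exists e : nat, \sum_(j < size s | a <= s`_j <= b) (-1) ^+ (k + j) * s`_j
    = (-1) ^+ e * altsum [seq t <- s | a <= t <= b].
Proof.
elim: s k => [|x s IHs] k xs; first by exists 0%N; rewrite big_ord0 mulr0.
have [ax|xa] := leP a x; last first.
  have [e IH] := IHs k.+1 (path_sorted xs).
  by exists e; rewrite sum_filter_cons IH /= leNgt xa add0r.
exists k; apply: altsum_filter_ge => //=; rewrite ax /=.
apply: sub_all (order_path_min lt_trans xs) => y xy.
exact: ltW (le_lt_trans ax xy).
Qed.

Lemma path_le_last x s z : path <%R x s -> z \in x :: s -> z <= last x s.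
Proof.
elim: s x z => [|y s IHs] x z /=; first by rewrite inE => _ /eqP ->.
move=> /andP[xy ys]; rewrite inE => /predU1P[->|zs]; last exact: IHs.
by rewrite (le_trans (ltW xy)) // IHs // mem_head.
Qed.

Lemma altsum_gaps g G s m : size s = m.*2 ->
  sorted (fun x y => g <= y - x <= G) s ->
  m%:R * g <= - altsum s <= m%:R * G.
Proof.
elim: m s => [|m IHm] [|x [|y s]] //= => [_ _|[/IHm IH] /andP[/andP[gy yG]]].
  by rewrite !mul0r oppr0 lexx.
by move=> /path_sorted /IH /andP[l1 l2]; rewrite -natr1; lra.
Qed.

Lemma path_gaps g G x s : path (fun x y => g <= y - x <= G) x s ->
  (size s)%:R * g <= last x s - x <= (size s)%:R * G.
Proof.
elim: s x => [|y s IHs] x /=; first by rewrite !mul0r subrr lexx.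
by move=> /andP[/andP[gy yG]] /IHs /andP[l1 l2]; rewrite -natr1; lra.
Qed.

(** The gap estimates are known for pairs of zeros with no zero between them;
    this turns them into a statement about neighbours in the list. *)
Lemma sorted_consecutive (e : rel R) s : sorted <%R s ->
  (forall x y, x \in s -> y \in s -> x < y ->
     (forall z, z \in s -> ~~ (x < z < y)) -> e x y) ->
  sorted e s.
Proof.
elim: s => [//|x [//|y s] IHs] /=.
move=> /andP[xy ys] H; apply/andP; split.
  apply: H; rewrite ?inE ?eqxx ?orbT // => z.
  rewrite !inE => /or3P[/eqP->|/eqP->|zs]; rewrite ?ltxx ?andbF //.
  have /allP /(_ _ zs) yz := order_path_min lt_trans ys.
  by rewrite [z < y]ltNge (ltW yz) andbF.
apply: IHs => // u v us vs uv nz; apply: H => //.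
- by rewrite inE us orbT.
- by rewrite inE vs orbT.
move=> z; rewrite inE => /predU1P[->|/nz //].
suff xu : x < u by rewrite [u < x]ltNge (ltW xu).
move: us; rewrite inE => /predU1P[->//|us].
have /allP /(_ _ us) := order_path_min lt_trans ys.
exact: lt_trans.
Qed.

(** Here theta plays the part of a zero set of which only two facts are kept:
    it meets every subinterval of [a, b] of length G, and its consecutive
    points in [a, b] are at least g apart.  With 2m points in [a, b], the
    alternating sum lies between m g and m G, and the length of [a, b] between
    (2m - 1) g and (2m + 1) G.  The first conclusion serves to bound m. *)
Lemma alternating_sum_gaps a b theta g G : a <= b -> 0 < g <= G ->
  sorted <%R theta ->
  ~~ odd (count (fun t => a <= t <= b) theta) ->
  (forall al, a <= al -> al + G <= b ->
     exists2 z, z \in theta & al <= z <= al + G) ->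
  (forall x y, x \in theta -> y \in theta -> a <= x -> x < y -> y <= b ->
     (forall z, z \in theta -> ~~ (x < z < y)) -> g <= y - x) ->
  exists m : nat, (m.*2%:R - 1) * g <= b - a /\
    `| `|alternating_sum a b theta| - (b - a) / 2 | <= m%:R * (G - g) + G / 2.
Proof.
move=> ab /andP[g0 gG] srt even_mid hit gap.
have G0 : 0 < G by exact: lt_le_trans gG.
set s := [seq t <- theta | a <= t <= b].
have s_srt : sorted <%R s by rewrite sorted_filter //; exact: lt_trans.
have mem_s t : (t \in s) = (a <= t <= b) && (t \in theta) by rewrite mem_filter.
have gaps : sorted (fun x y => g <= y - x <= G) s.
  apply: sorted_consecutive => // x y; rewrite !mem_s.
  move=> /andP[/andP[ax xb] xt] /andP[/andP[ay yb] yt] xy nz.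
  apply/andP; split.
    apply: gap => // z zt; apply/negP => /andP[xz zy].
    have := nz z; rewrite mem_s zt xz zy => /(_ _)/negP; apply => //.
    by rewrite (le_trans ax (ltW xz)) (le_trans (ltW zy) yb).
  rewrite leNgt; apply/negP => Gxy.
  (* An interval of length G centred between x and y. *)
  have [||z zt /andP[z1 z2]] := hit (x + (y - x - G) / 2); [lra|lra|].
  have := nz z; rewrite mem_s zt; have -> : a <= z <= b by lra.
  by move=> /(_ isT) /negP; apply; lra.
have [m sz] : exists m, size s = m.*2.
  exists (size s)./2; rewrite size_filter.
  have := odd_double_half (count (fun t => a <= t <= b) theta).
  by rewrite (negbTE even_mid) add0n => ->.
have [e altE] := altsum_filter a b 1 srt.
have /andP[s1 s2] := altsum_gaps sz gaps.
have -> : `|alternating_sum a b theta| = - altsum s.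
  rewrite /alternating_sum altE normrMsign ler0_norm //.
  by rewrite -oppr_ge0 (le_trans _ s1) // mulr_ge0 // ltW.
have [len1 len2] : (m.*2%:R - 1) * g <= b - a /\ b - a <= (m.*2%:R + 1) * G.
  case def_s : s sz gaps => [|x s'] sz gaps.
    have -> : m = 0%N by move: sz; case: (m).
    rewrite sub0r mulN1r add0r mul1r; split; first lra.
    rewrite leNgt; apply/negP => Gab.
    have [||z zt zi] := hit a; [lra|lra|].
    suff : z \in s by rewrite def_s.
    by rewrite mem_s zt andbT; lra.
  have : m.*2%:R = (size s')%:R + 1 :> R by rewrite -sz natr1.
  move=> ->; have /andP[p1 p2] := path_gaps gaps.
  have xs : x \in s by rewrite def_s mem_head.
  have ls : last x s' \in s by rewrite def_s mem_last.
  move: (xs) (ls); rewrite !mem_s => /andP[/andP[ax xb] _] /andP[/andP[al lb] _].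
  split; first lra.
  have Ea : x - a <= G.
    rewrite leNgt; apply/negP => Gx.
    have [||z zt zi] := hit a; [lra|lra|].
    have : z \in s by rewrite mem_s zt andbT; lra.
    rewrite def_s inE => /predU1P[zx|zs]; first lra.
    move: s_srt; rewrite def_s /= => /(order_path_min lt_trans)/allP/(_ _ zs).
    by lra.
  have Eb : b - last x s' <= G.
    rewrite leNgt; apply/negP => Gx.
    have [||z zt zi] := hit (b - G); [lra|lra|].
    have : z \in s by rewrite mem_s zt andbT; lra.
    rewrite def_s => /path_le_last; move: s_srt; rewrite def_s => + zl.
    by move=> /zl; lra.
  by lra.
exists m; split=> //.
by rewrite ler_norml; move: len1 len2; rewrite -muln2 natrM; lra.
Qed.

End AlternatingSums.

(** * The alternating sum of the zeros *)

Theorem theorem1p1 (R : realType) (P : nat -> {poly R})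
    (hP : legendre_polynomials P)
    (a b : R) (ha : 0 < a) (hab : a <= b) (hb : b < pi) :
  exists C : R,
    forall (n : nat) (theta : seq R),
      (1 <= n)%N ->
      increasing_cos_zeros (P n) theta ->
      ~~ odd (count (fun t => a <= t <= b) theta) ->
      `| `|alternating_sum a b theta| - (b - a) / 2 | <= C / n%:R.
Proof.
have in_pi t : a <= t <= b -> 0 < t < pi by move=> /andP[? ?]; lra.
(* The minimum of sin on [a, b] is positive, which bounds the potential. *)
have [c cab sin_min] :
    exists2 c, a <= c <= b & forall t, a <= t <= b -> sin c <= sin t.
  have [|c] := @EVT_min R sin a b hab.
    by apply: continuous_subspaceT; exact: continuous_sin.
  by rewrite in_itv /= => cab sin_min; exists c.
have sc := sin_gt0_pi (in_pi c cab).
pose K := (4 * sin c ^+ 2)^-1.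
have K0 : 0 < K by rewrite invr_gt0 mulr_gt0 // exprn_gt0.
exists (pi * (K + 1)) => n theta n1 [srt theta_zeros] even_count.
have nR : 1 <= n%:R :> R by rewrite ler1n.
pose N : R := n%:R + 2^-1; pose M := N + K / N.
have nN : n%:R <= N by rewrite /N; lra.
have N1 : 1 <= N by exact: le_trans nN.
have N0 : 0 < N by lra.
have KN0 : 0 < K / N by rewrite divr_gt0.
have M0 : 0 < M by rewrite addr_gt0.
have QM t : a <= t <= b -> legendre_potential n t <= M ^+ 2.
  move=> tab; have st := sin_gt0_pi (in_pi t tab).
  have : (4 * sin t ^+ 2)^-1 <= K.
    rewrite lef_pV2 ?posrE ?mulr_gt0 ?exprn_gt0 // ler_pM2l //.
    by rewrite ler_pXn2r ?nnegrE ?(ltW st) ?(ltW sc) ?sin_min.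
  rewrite /legendre_potential -/N => QK.
  (* M is a rational substitute for the square root of N^2 + K. *)
  have -> : M ^+ 2 = N ^+ 2 + 2 * K + (K / N) ^+ 2 by rewrite /M; field; lra.
  have := sqr_ge0 (K / N); lra.
have zerosE t : a <= t <= b -> (t \in theta) = (legendre_u P n t == 0).
  move=> /in_pi tpi; rewrite legendre_u_eq0 //; apply/idP/eqP.
    by move=> /theta_zeros [].
  by move=> Pt; apply/theta_zeros; case/andP: tpi.
have pi0 := pi_gt0 R.
have [|al a_al alb|x y xt yt ax xy yb nz|m [len_m close]] :=
  @alternating_sum_gaps R a b theta (pi / M) (pi / N) hab _ srt even_count.
- rewrite divr_gt0 //= ler_pM2l // lef_pV2 ?posrE // /M; lra.
- have sub x : al <= x <= al + pi / N -> a <= x <= b by move=> /andP[? ?]; lra.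
  have [z zal uz] := @sturm_zero R (legendre_u P n) (legendre_u1 P n)
    (legendre_potential n) N al N0
    (fun x xi => is_derive_legendre_u P n (in_pi x (sub x xi)))
    (fun x xi => is_derive_legendre_u1 hP n (in_pi x (sub x xi)))
    (fun x _ => legendre_potential_ge n x).
  by exists z => //; rewrite zerosE ?uz ?sub.
- have sub z : x <= z <= y -> a <= z <= b by move=> /andP[? ?]; lra.
  apply: (@sturm_gap R (legendre_u P n) (legendre_u1 P n) (legendre_potential n)
    M x y M0 xy
    (fun x xi => is_derive_legendre_u P n (in_pi x (sub x xi)))
    (fun x xi => is_derive_legendre_u1 hP n (in_pi x (sub x xi)))
    (fun z zi => QM z (sub z zi))).
  + by apply/eqP; rewrite -zerosE // sub // lexx ltW.
  + by apply/eqP; rewrite -zerosE // sub // lexx ltW.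
  + move=> z /andP[xz zy]; rewrite -zerosE ?sub ?ltW //.
    by apply/negP => zt; have := nz z zt; rewrite xz zy.
apply: le_trans close _.
apply: (@le_trans _ _ (pi * (K + 1) / N)); last first.
  by rewrite ler_pM2l ?lef_pV2 ?posrE ?mulr_gt0 //; lra.
have gapE : pi / N - pi / M = pi / M * (K / N ^+ 2).
  rewrite /M; field; apply/andP; split; first lra.
  by rewrite gt_eqF // addr_gt0 // mulr_gt0.
have g0 : 0 < pi / M by rewrite divr_gt0.
(* From (2m - 1) pi/M <= b - a <= pi and pi/M <= pi. *)
have m_bound : m%:R * (pi / M) <= pi.
  move: len_m; rewrite -muln2 natrM.
  have : pi / M <= pi.
    rewrite ler_pdivrMr // ler_peMr ?(ltW pi0) //.
    by rewrite (le_trans N1) // lerDl ltW.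
  lra.
rewrite gapE.
have -> : m%:R * (pi / M * (K / N ^+ 2)) = m%:R * (pi / M) * (K / N ^+ 2) by ring.
have : m%:R * (pi / M) * (K / N ^+ 2) <= pi * (K / N).
  apply: ler_pM => //; first by rewrite mulr_ge0 // ltW.
    by rewrite divr_ge0 ?sqr_ge0 // ltW.
  by rewrite ler_pM2l // lef_pV2 ?posrE ?exprn_gt0 // ler_eXnr.
have : 0 <= pi / N by rewrite divr_ge0 // ltW.
have -> : pi * (K + 1) / N = pi * (K / N) + pi / N by ring.
lra.
Qed.
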